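(* Let $A$ be an associative algebra over an algebraically closed field $\mathbb{F}$ of characteristic zero. Suppose $A$ admits a nondegenerate regular $G$-grading, where $G$ is a finite group, with commutation function $\theta$, and let $M_G$ be its commutation matrix. Then $M_G^2=|G|\cdot Id$ (an identity of $|G|\times|G|$ matrices over the twisted group algebra $\mathbb{F}^\alpha G$ used to define $M_G$).
   Context: For $\bar g=(g_1,\dots,g_n)\in G^n$ let $Sym(\bar g)=\{\sigma\in Sym(n): g_1\cdots g_n=g_{\sigma(1)}\cdots g_{\sigma(n)}\}$. A $G$-grading $A=\bigoplus_{g\in G}A_g$ (with $A_gA_h\subseteq A_{gh}$) is regular, with commutation function $\theta$, if: for every $n\geq 1$, $\bar g\in G^n$, $\sigma\in Sym(\bar g)$ there is $\theta_{(\bar g,\sigma)}\in\mathbb{F}^\times$ with $a_1\cdots a_n=\theta_{(\bar g,\sigma)}a_{\sigma(1)}\cdots a_{\sigma(n)}$ for all $a_i\in A_{g_i}$; and for every $n\geq 1$, $\bar g\in G^n$ there are $a_i\in A_{g_i}$ with $a_1\cdots a_n\ne0$. For commuting $g,h$ write $\theta_{g,h}=\theta_{((g,h),(1\,2))}$. The grading is nondegenerate if for every $e\ne g\in G$ there is $g'\in C_G(g)$ with $\theta_{g,g'}\neq1$. Commutation matrix. The map $\psi(g)=\theta_{g,g}$ is a homomorphism $G\to\{\pm1\}$. Let $\tau$ be the commutation function of the infinite-dimensional Grassmann algebra with its even/odd $\{\pm1\}$-grading: $\tau_{\epsilon,\epsilon'}=-1$ if $\epsilon=\epsilon'=-1$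 and $1$ otherwise, and $\tau_{((\epsilon_1,\dots,\epsilon_n),\sigma)}=(-1)^{N}$ where $N$ is the number of pairs $i<j$ with $\sigma(i)>\sigma(j)$ and $\epsilon_{\sigma(i)}=\epsilon_{\sigma(j)}=-1$. Put $(\tau\theta)_{(\bar g,\sigma)}=\tau_{((\psi(g_1),\dots,\psi(g_n)),\sigma)}\,\theta_{(\bar g,\sigma)}$. There is a 2-cocycle $\alpha\in Z^2(G,\mathbb{F}^\times)$, unique up to coboundaries, such that the twisted group algebra $\mathbb{F}^\alpha G$ (with basis $\{U_g\}_{g\in G}$, product $U_gU_h=\alpha(g,h)U_{gh}$, and natural $G$-grading, which is regular) has commutation function $\tau\theta$. The commutation matrix $M_G$ is the $|G|\times|G|$ matrix over $\mathbb{F}^\alpha G$, indexed by $G\times G$, with entries $$(M_G)_{g,h}=\tau_{\psi(g),\psi(h)}\,U_gU_hU_g^{-1}U_h^{-1}$$ (these do not depend on rescaling the basis elements $U_g$). $Id$ is the identity matrix over $\mathbb{F}^\alpha G$ (diagonal entries the unit of $\mathbb{F}^\alpha G$). *)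

(* Defs.v *)
From HB Require Import structures.
From mathcomp Require Import all_boot all_order all_algebra all_fingroup.
From mathcomp Require Import all_field.

Set Implicit Arguments.
Unset Strict Implicit.
Unset Printing Implicit Defensive.

Import GRing.Theory.
Local Open Scope ring_scope.

(* Associative algebras are not assumed unital, whereas algType is.  The carrier
   may be infinite dimensional. *)
Record assocAlgebra (F : fieldType) := AssocAlgebra {
  aa_carrier :> lmodType F;
  aa_mul : aa_carrier -> aa_carrier -> aa_carrier;
  aa_mulA : associative aa_mul;
  aa_linearl : forall y, linear (aa_mul^~ y);
  aa_linearr : forall x, linear (aa_mul x)
}.

Section OfAlgType.

Variables (F : fieldType) (A : algType F).

Fact algType_linearl (y : A) : linear ( *%R^~ y).
Proof. by move=> c u v; rewrite mulrDl scalerAl. Qed.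

Fact algType_linearr (x : A) : linear ( *%R x).
Proof. by move=> c u v; rewrite mulrDr scalerAr. Qed.

Definition assoc_of_algType : assocAlgebra F :=
  AssocAlgebra (@mulrA A) algType_linearl algType_linearr.

End OfAlgType.

Section Grading.

Variables (F : fieldType) (gT : finGroupType).

(* x_1 x_2 ... x_n for n >= 1; the value on the empty sequence is junk. *)
Definition aa_prod (A : assocAlgebra F) (s : seq A) : A :=
  if s is x :: s' then foldl (@aa_mul F A) x s' else 0.

Definition is_subspace (A : assocAlgebra F) (W : A -> Prop) : Prop :=
  W 0 /\ (forall (c : F) u v, W u -> W v -> W (c *: u + v)).

Record is_grading (A : assocAlgebra F) (comp : gT -> A -> Prop) : Prop := {
  grading_subspace : forall g, is_subspace (comp g);
  grading_span : forall x : A,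
    exists2 v : gT -> A, (forall g, comp g (v g)) & x = \sum_g v g;
  grading_direct : forall v : gT -> A,
    (forall g, comp g (v g)) -> \sum_g v g = 0 -> forall g, v g = 0;
  grading_mul : forall g h x y,
    comp g x -> comp h y -> comp (g * h)%g (aa_mul x y)
}.

Definition SymT n (g : n.-tuple gT) : {set 'S_n} :=
  [set s : 'S_n |
    (\prod_(i < n) tnth g i == \prod_(i < n) tnth g (s i))%g].

(* A commutation function assigns a scalar to every pair (g, s); only its values
   at n >= 1 and s \in SymT g are meaningful. *)
Definition comm_fun := forall n, n.-tuple gT -> 'S_n -> F.

Record is_regular_grading (A : assocAlgebra F) (comp : gT -> A -> Prop)
    (theta : comm_fun) : Prop := {
  regular_grading : is_grading comp;
  regular_comm : forall n (g : n.-tuple gT) (s : 'S_n),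
    (0 < n)%N -> s \in SymT g ->
    theta n g s != 0 /\
    forall a : 'I_n -> A, (forall i, comp (tnth g i) (a i)) ->
      aa_prod [seq a i | i : 'I_n] =
        theta n g s *: aa_prod [seq a (s i) | i : 'I_n];
  regular_neq0 : forall n (g : n.-tuple gT), (0 < n)%N ->
    exists2 a : 'I_n -> A, (forall i, comp (tnth g i) (a i)) &
      aa_prod [seq a i | i : 'I_n] != 0
}.

Definition comm2 (theta : comm_fun) (g h : gT) : F :=
  theta 2 [tuple g; h] (tperm ord0 ord_max).

Definition is_nondegenerate (theta : comm_fun) : Prop :=
  forall g : gT, g != 1%g -> exists2 g', g' \in 'C[g]%g & comm2 theta g g' != 1.

Definition psi (theta : comm_fun) (g : gT) : F := comm2 theta g g.

(* Signs 1 and -1 are represented by the corresponding elements of F. *)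
Definition tau2 (e e' : F) : F := if (e == -1) && (e' == -1) then -1 else 1.

Definition tau n (e : n.-tuple F) (s : 'S_n) : F :=
  (-1) ^+ #|[set p : 'I_n * 'I_n |
              [&& (p.1 < p.2)%N, (s p.2 < s p.1)%N,
                  tnth e (s p.1) == -1 & tnth e (s p.2) == -1]]|.

Definition tau_twist (theta : comm_fun) : comm_fun :=
  fun n g s => tau [tuple of map (psi theta) g] s * theta n g s.

(* 2-cocycles for the trivial action of the group on F^*; not normalised. *)
Record cocycle := Cocycle {
  coc :> gT -> gT -> F;
  coc_neq0 : forall g h, coc g h != 0;
  cocP : forall g h k,
    coc g h * coc (g * h)%g k = coc h k * coc g (h * k)%g
}.

End Grading.

Lemma tau2E (F : fieldType) (e e' : F) :
  tau2 e e' = tau [tuple e; e'] (tperm ord0 ord_max).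
Proof.
rewrite /tau2 /tau; set S := [set p | _].
have memS p : (p \in S) =
    [&& p == (ord0, ord_max), e == -1 & e' == -1].
  rewrite inE; case: p => [[[|[|//]] hi] [[|[|//]] hj]] /=;
    rewrite ?ltnn ?andbF //=.
  have -> : Ordinal hi = ord0 by apply: val_inj.
  have -> : Ordinal hj = ord_max by apply: val_inj.
  by rewrite tpermL tpermR !(tnth_nth 0) /= andbC.
case: ifP => ee'.
  have -> : S = [set (ord0, ord_max)].
    by apply/setP => p; rewrite memS ee' andbT inE.
  by rewrite cards1 expr1.
have -> : S = set0 by apply/setP => p; rewrite memS ee' andbF inE.
by rewrite cards0 expr0.
Qed.

(* The element x of the twisted group algebra stands for \sum_g x g *: U_g.  Here F^o is
   F, seen as a module over itself. *)
Definition twisted_group_algebra (F : fieldType) (gT : finGroupType)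
  (a : cocycle F gT) : Type := {ffun gT -> F^o}.

Section TwistedGroupAlgebra.

Variables (F : fieldType) (gT : finGroupType) (a : cocycle F gT).
Local Notation T := (twisted_group_algebra a).

HB.instance Definition _ := Vector.copy T {ffun gT -> F^o}.

Implicit Types (x y z : T) (g h k : gT).

Definition tgaU g : T := [ffun h => (h == g)%:R].

Definition tga_mul x y : T :=
  \sum_g \sum_h (x g * y h * a g h) *: tgaU (g * h)%g.

Definition tga_one : T := (a 1%g 1%g)^-1 *: tgaU 1%g.

Lemma tgaUE g h : tgaU g h = (h == g)%:R.
Proof. by rewrite /tgaU ffunE. Qed.

Lemma tga_basis x : x = \sum_g x g *: tgaU g.
Proof.
apply/ffunP => k; rewrite sum_ffunE (bigD1 k) //= ffunE tgaUE eqxx.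
rewrite big1 ?addr0 => [|g gk]; first by rewrite [RHS]mulr1.
by rewrite ffunE tgaUE eq_sym (negPf gk) scaler0.
Qed.

Fact tga_linearl y : linear (tga_mul^~ y).
Proof.
move=> c x x'; rewrite /tga_mul scaler_sumr -big_split /=.
apply: eq_bigr => g _; rewrite scaler_sumr -big_split /=.
by apply: eq_bigr => h _; rewrite !ffunE scalerA -scalerDl !mulrDl !mulrA.
Qed.

Fact tga_linearr x : linear (tga_mul x).
Proof.
move=> c y y'; rewrite /tga_mul scaler_sumr -big_split /=.
apply: eq_bigr => g _; rewrite scaler_sumr -big_split /=.
apply: eq_bigr => h _; rewrite !ffunE scalerA -scalerDl mulrDr mulrDl.
by rewrite !mulrA [c * x g]mulrC.
Qed.

Lemma tga_mulUU g h : tga_mul (tgaU g) (tgaU h) = a g h *: tgaU (g * h)%g.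
Proof.
rewrite /tga_mul (bigD1 g) //= (bigD1 h) //= !tgaUE !eqxx !mul1r.
rewrite [X in _ + X + _]big1 => [|k kh]; last first.
  by rewrite !tgaUE (negPf kh) mulr0 mul0r scale0r.
rewrite big1 ?addr0 // => k kg; rewrite big1 // => l _.
by rewrite !tgaUE (negPf kg) !mul0r scale0r.
Qed.

Lemma tga_linear_ext (f f' : T -> T) :
  linear f -> linear f' -> (forall g, f (tgaU g) = f' (tgaU g)) -> f =1 f'.
Proof.
move=> Lf Lf' eqf x.
pose lf : {linear T -> T} := HB.pack f (GRing.isLinear.Build F T T _ f Lf).
pose lf' : {linear T -> T} := HB.pack f' (GRing.isLinear.Build F T T _ f' Lf').
rewrite [x]tga_basis -[f]/(lf : T -> T) -[f']/(lf' : T -> T) !linear_sum.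
by apply: eq_bigr => g _; rewrite !linearZ /= eqf.
Qed.

Let mulZl c x y : tga_mul (c *: x) y = c *: tga_mul x y.
Proof.
have L := tga_linearl y; have := L (-1) 0 0.
rewrite !scaleN1r oppr0 addr0 addNr => L0.
by have := L c x 0; rewrite /= L0 !addr0.
Qed.

Let mulZr c x y : tga_mul x (c *: y) = c *: tga_mul x y.
Proof.
have L := tga_linearr x; have := L (-1) 0 0.
rewrite !scaleN1r oppr0 addr0 addNr => L0.
by have := L c y 0; rewrite /= L0 !addr0.
Qed.

Fact tga_mulA : associative tga_mul.
Proof.
move=> x y z.
apply: (@tga_linear_ext (tga_mul^~ (tga_mul y z))
                        (fun x => tga_mul (tga_mul x y) z)) x => [||g].
- exact: tga_linearl.
- by move=> c u v /=; rewrite !tga_linearl.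
apply: (@tga_linear_ext (fun y => tga_mul (tgaU g) (tga_mul y z))
                        (fun y => tga_mul (tga_mul (tgaU g) y) z)) y => [||h].
- by move=> c u v /=; rewrite tga_linearl tga_linearr.
- by move=> c u v /=; rewrite tga_linearr tga_linearl.
apply: (@tga_linear_ext (fun z => tga_mul (tgaU g) (tga_mul (tgaU h) z))
                        (tga_mul (tga_mul (tgaU g) (tgaU h)))) z => [||k].
- by move=> c u v /=; rewrite !tga_linearr.
- exact: tga_linearr.
by rewrite !tga_mulUU mulZr mulZl !tga_mulUU !scalerA cocP mulgA.
Qed.

Lemma coc1g g : a 1%g g = a 1%g 1%g.
Proof.
have := cocP a 1%g 1%g g; rewrite !mul1g => e.
by apply: (mulIf (coc_neq0 a 1%g g)); rewrite e.
Qed.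

Lemma cocg1 g : a g 1%g = a 1%g 1%g.
Proof.
have := cocP a g 1%g 1%g; rewrite !mulg1 => e.
by apply: (mulIf (coc_neq0 a g 1%g)); rewrite e.
Qed.

Fact tga_mul1 : left_id tga_one tga_mul.
Proof.
move=> x; apply: (@tga_linear_ext (tga_mul tga_one) id) x => //.
  exact: tga_linearr.
move=> g; rewrite mulZl tga_mulUU scalerA mul1g coc1g.
by rewrite mulVf ?coc_neq0 // scale1r.
Qed.

Fact tga_mulr1 : right_id tga_one tga_mul.
Proof.
move=> x; apply: (@tga_linear_ext (tga_mul^~ tga_one) id) x => //.
  exact: tga_linearl.
move=> g; rewrite mulZr tga_mulUU scalerA mulg1 cocg1.
by rewrite mulVf ?coc_neq0 // scale1r.
Qed.

Fact tga_mulDl : left_distributive tga_mul +%R.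
Proof. by move=> x y z; have := tga_linearl z 1 x y; rewrite !scale1r. Qed.

Fact tga_mulDr : right_distributive tga_mul +%R.
Proof. by move=> x y z; have := tga_linearr x 1 y z; rewrite !scale1r. Qed.

Fact tga_one_neq0 : tga_one != 0.
Proof.
apply/eqP => /ffunP /(_ 1%g); rewrite !ffunE eqxx => /eqP.
by rewrite [_ *: _]mulr1 invr_eq0 (negPf (coc_neq0 a _ _)).
Qed.

HB.instance Definition _ := GRing.Zmodule_isNzRing.Build T
  tga_mulA tga_mul1 tga_mulr1 tga_mulDl tga_mulDr tga_one_neq0.

Fact tga_scaleAl (c : F) x y : c *: (x * y) = (c *: x) * y.
Proof. by rewrite /GRing.mul /= mulZl. Qed.

Fact tga_scaleAr (c : F) x y : c *: (x * y) = x * (c *: y).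
Proof. by rewrite /GRing.mul /= mulZr. Qed.

HB.instance Definition _ := GRing.Lmodule_isLalgebra.Build F T tga_scaleAl.
HB.instance Definition _ := GRing.Lalgebra_isAlgebra.Build F T tga_scaleAr.
HB.instance Definition _ := Algebra_isFalgebra.Build F T.

Lemma tgaUM g h : tgaU g * tgaU h = a g h *: tgaU (g * h)%g.
Proof. exact: tga_mulUU. Qed.

Lemma tga1E : 1 = (a 1%g 1%g)^-1 *: tgaU 1%g :> T.
Proof. by []. Qed.

Lemma tgaU_unit g : tgaU g \is a GRing.unit.
Proof.
have U1 : tgaU 1%g \is a GRing.unit.
  have -> : tgaU 1%g = a 1%g 1%g *: (1 : T).
    by rewrite tga1E scalerA divff ?coc_neq0 // scale1r.
  by rewrite scaler_unit ?unitr1 // unitfE coc_neq0.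
have P h k : (h * k = 1)%g -> tgaU h * tgaU k \is a GRing.unit.
  by move=> hk; rewrite tgaUM hk scaler_unit // unitfE coc_neq0.
apply/unitrP.
have := P _ _ (mulgV g); have := P _ _ (mulVg g).
set V := tgaU g^-1%g => VU UV.
have e1 : (V * tgaU g)^-1 * V * tgaU g = 1 by rewrite -mulrA mulVr.
have e2 : tgaU g * (V * (tgaU g * V)^-1) = 1 by rewrite mulrA mulrV.
exists ((V * tgaU g)^-1 * V); split=> //.
have -> : (V * tgaU g)^-1 * V = V * (tgaU g * V)^-1; last exact: e2.
by rewrite -[LHS]mulr1 -[in LHS]e2 [LHS]mulrA e1 mul1r.
Qed.

Definition tga_comp g (x : T) : Prop := exists c : F, x = c *: tgaU g.

(* The inverses are genuine ones, by tgaU_unit.  Rows and columns are indexed by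
   the elements of the group through enum_val. *)
Definition commutation_mx (theta : comm_fun F gT) : 'M[T]_#|gT| :=
  \matrix_(i, j)
    let g := enum_val i in let h := enum_val j in
    tau2 (psi theta g) (psi theta h) *:
      (tgaU g * tgaU h * (tgaU g)^-1 * (tgaU h)^-1).

End TwistedGroupAlgebra.

Arguments tga_comp {F gT} a g x.
Arguments commutation_mx {F gT} a theta.

(* Main.v *)
Require Import Defs.
From HB Require Import structures.
From mathcomp Require Import all_boot all_order all_algebra all_fingroup.
From mathcomp Require Import all_field.

Set Implicit Arguments.
Unset Strict Implicit.
Unset Printing Implicit Defensive.

Import GRing.Theory.
Local Open Scope ring_scope.

(** Write [S w] for the sum over [k] of [tau2 (psi w) (psi k)] times the conjugate
    [U_k U_w U_k^-1].  In the [(g, h)] entry of the square of the commutation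
    matrix the inner factors of the two commutators cancel, leaving the sum over
    [k] of [U_g (U_k (U_g^-1 U_h) U_k^-1) U_h^-1] with sign
    [tau2 (psi g) (psi k) * tau2 (psi k) (psi h)].  The element [U_g^-1 U_h] is
    proportional to [U_w], where [w = g^-1 h]; since [psi] is a homomorphism to
    the signs and [tau2] is bimultiplicative with square 1, the sign is
    [tau2 (psi w) (psi k)].  So the entry is a multiple of [U_g S(w) U_h^-1]
    ([commutation_mx_sqrE]).

    For [w = 1] every summand of [S w] is [U_1], which gives the diagonal.  For
    [w <> 1], choose [c] commuting with [w] such that [comm2 theta w c <> 1].
    The commutation of [U_w] with [U_c] involves the scalar
    [tau2 (psi w) (psi c) * comm2 theta w c], and the substitution [k -> k c]
    absorbs its first factor, so that [S w = comm2 theta w c *: S w]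
    ([twisted_conj_sum_scale]) and [S w = 0].  This is the usual orthogonality
    argument for characters.

    It remains to see that [psi] is a homomorphism even when [g] and [h] do not
    commute ([psiM]).  In any regular grading, exchanging two elements of degree
    [gh], each split into a factor of degree [g] and one of degree [h], shows
    that [psi (gh)] is the value of the commutation function on [(g, h, g, h)]
    and the permutation exchanging the two halves ([psiE]).  Apply this to both
    gradings.  In the twisted group algebra [U_g] commutes with itself, so both
    sides are 1 there; but the right-hand side is the value for [theta] times a
    Grassmann sign, which equals [psi g * psi h] ([tau_block_swap]).  Hence the
    value for [theta] is [psi g * psi h] too. *)

(** * Grassmann signs *)

Lemma tau2C {F : fieldType} (e e' : F) : tau2 e e' = tau2 e' e.
Proof. by rewrite /tau2 andbC. Qed.

Lemma tau2_sqr {F : fieldType} (e e' : F) : tau2 e e' * tau2 e e' = 1.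
Proof. by rewrite /tau2; case: ifP; rewrite ?mulrNN mulr1. Qed.

Lemma tau2_1l {F : fieldType} (e : F) : tau2 1 e = 1.
Proof. by rewrite /tau2; case: (eqVneq (1 : F) (-1)) => // <-; case: ifP. Qed.

Lemma tau2Ml {F : fieldType} (e1 e2 e' : F) :
  (e1 == 1) || (e1 == -1) -> (e2 == 1) || (e2 == -1) ->
  tau2 (e1 * e2) e' = tau2 e1 e' * tau2 e2 e'.
Proof.
case/orP=> /eqP->; first by rewrite tau2_1l !mul1r.
by case/orP=> /eqP->; rewrite ?mulrNN !mulr1 ?tau2_1l ?mulr1 ?tau2_sqr.
Qed.

(** A permutation contributes one elementary sign for each pair that it inverts,
    which makes [tau] computable by expanding the products. *)
Lemma tau_prod_tau2 {F : fieldType} n (e : n.-tuple F) (s : 'S_n) :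
  tau e s = \prod_(i < n) \prod_(j < n | (i < j)%N && (s j < s i)%N)
              tau2 (tnth e (s i)) (tnth e (s j)).
Proof.
rewrite pair_big_dep /= /tau -prodr_const /tau2 -big_mkcondr /=.
by apply: eq_bigl => p; rewrite inE -!andbA.
Qed.

(** The permutation [i |-> i + 2] modulo 4, so that [x_0 x_1 x_2 x_3] becomes
    [x_2 x_3 x_0 x_1]. *)
Definition block_swap : 'S_4 := perm (addrI (2%:R : 'I_4)).

(** The inverted pairs are those taking one index in each half.  The two mixed
    pairs contribute the same sign and cancel; the pairs [(e, e)] and [(e', e')]
    contribute [e] and [e']. *)
Lemma tau_block_swap {F : fieldType} (e e' : F) :
  (e == 1) || (e == -1) -> (e' == 1) || (e' == -1) ->
  tau [tuple e; e'; e; e'] block_swap = e * e'.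
Proof.
have tau2_diag (c : F) : (c == 1) || (c == -1) -> tau2 c c = c.
  by case/orP=> /eqP->; [rewrite tau2_1l | rewrite /tau2 eqxx].
move=> he he'.
rewrite tau_prod_tau2 !big_ord_recl !big_ord0.
rewrite !(big_mkcond (fun j => _ && _)) /= !big_ord_recl !big_ord0 /=.
rewrite !permE /= !(tnth_nth 0) /= !mulr1 !mul1r.
rewrite !tau2_diag // [tau2 e' e]tau2C.
by rewrite mulrA -(mulrA e) tau2_sqr mulr1.
Qed.

(** * Commutation in a regular grading *)

Lemma scaler_injr {F : fieldType} {V : lmodType F} (v : V) (a b : F) :
  v != 0 -> a *: v = b *: v -> a = b.
Proof.
move=> v_neq0 /eqP; rewrite -subr_eq0 -scalerBl scaler_eq0 (negPf v_neq0) orbF.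
by rewrite subr_eq0 => /eqP.
Qed.

Lemma SymT_comm {gT : finGroupType} (g h : gT) :
  commute g h -> tperm ord0 ord_max \in SymT [tuple g; h].
Proof.
move=> cgh; rewrite inE !big_ord_recl !big_ord0 !mulg1.
have -> : lift ord0 ord0 = ord_max :> 'I_2 by apply: val_inj.
by rewrite tpermL tpermR !(tnth_nth 1%g) /= cgh.
Qed.

Lemma SymT_block_swap {gT : finGroupType} (g h : gT) :
  block_swap \in SymT [tuple g; h; g; h].
Proof.
by rewrite inE !big_ord_recl !big_ord0 !permE !(tnth_nth 1%g).
Qed.

Lemma regular_comm2 {F : fieldType} {gT : finGroupType} {A : assocAlgebra F}
    {comp : gT -> A -> Prop} {theta : comm_fun F gT} {g h : gT} {x y : A} :
  is_regular_grading comp theta -> commute g h -> comp g x -> comp h y ->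
  aa_mul x y = comm2 theta g h *: aa_mul y x.
Proof.
move=> regA cgh gx hy; pose a i := tnth [tuple x; y] i.
have aP i : comp (tnth [tuple g; h] i) (a i).
  by rewrite /a (tnth_nth 1%g) (tnth_nth 0); case: i => [[|[|//]] ?].
have [_ /(_ a aP)] := regular_comm regA (isT : (0 < 2)%N) (SymT_comm cgh).
rewrite /image_mem !enum_ordSl enum_ord0 /=.
have -> : lift ord0 ord0 = ord_max :> 'I_2 by apply: val_inj.
by rewrite tpermL tpermR /a !(tnth_nth 0).
Qed.

Lemma regular_comm_block_swap {F : fieldType} {gT : finGroupType}
    {A : assocAlgebra F} {comp : gT -> A -> Prop} {theta : comm_fun F gT}
    {g h : gT} {x y z t : A} :
  is_regular_grading comp theta ->
  comp g x -> comp h y -> comp g z -> comp h t ->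
  aa_mul (aa_mul x y) (aa_mul z t) =
    theta _ [tuple g; h; g; h] block_swap *: aa_mul (aa_mul z t) (aa_mul x y).
Proof.
move=> regA gx hy gz ht; pose a i := tnth [tuple x; y; z; t] i.
have aP i : comp (tnth [tuple g; h; g; h] i) (a i).
  by rewrite /a (tnth_nth 1%g) (tnth_nth 0); case: i => [[|[|[|[|//]]]] ?].
have [_ /(_ a aP)] :=
  regular_comm regA (isT : (0 < 4)%N) (SymT_block_swap g h).
rewrite /image_mem !enum_ordSl enum_ord0 /= !permE /a !(tnth_nth 0) /=.
by rewrite !aa_mulA.
Qed.

(** Regularity provides [x y z t <> 0] of degrees [g, h, g, h].  Both scalars then
    relate this product to [z t x y]: the left one by exchanging [x y] and [z t],
    both of degree [gh], the right one by permuting the four factors. *)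
Lemma psiE {F : fieldType} {gT : finGroupType} {A : assocAlgebra F}
    {comp : gT -> A -> Prop} {theta : comm_fun F gT} :
  is_regular_grading comp theta ->
  forall g h, psi theta (g * h)%g = theta _ [tuple g; h; g; h] block_swap.
Proof.
move=> regA g h.
have [a aP] := regular_neq0 regA [tuple g; h; g; h] isT.
rewrite /image_mem !enum_ordSl enum_ord0 /= -aa_mulA.
have := aP (lift ord0 (lift ord0 (lift ord0 ord0))).
have := aP (lift ord0 (lift ord0 ord0)); have := aP (lift ord0 ord0).
have := aP ord0; rewrite !(tnth_nth 1%g) /=.
move: (a _) (a _) (a _) (a _) => t z y x gx hy gz ht xyzt_neq0.
have ghxy := grading_mul (regular_grading regA) gx hy.
have ghzt := grading_mul (regular_grading regA) gz ht.
have ztxy_neq0 : aa_mul (aa_mul z t) (aa_mul x y) != 0.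
  apply: contraNneq xyzt_neq0 => ztxy0.
  by rewrite (regular_comm_block_swap regA gx hy gz ht) ztxy0 scaler0.
apply: (scaler_injr ztxy_neq0).
rewrite -(regular_comm_block_swap regA gx hy gz ht) /psi.
by rewrite -(regular_comm2 regA (erefl _) ghxy ghzt).
Qed.

Lemma comm2_tau_twist {F : fieldType} {gT : finGroupType}
    (theta : comm_fun F gT) (g h : gT) :
  comm2 (tau_twist theta) g h =
    tau2 (psi theta g) (psi theta h) * comm2 theta g h.
Proof.
by rewrite tau2E /comm2 /tau_twist; congr (tau _ _ * _); apply: val_inj.
Qed.

Section TwistedGroupAlgebra.

Context {F : fieldType} {gT : finGroupType} {alpha : cocycle F gT}.
Local Notation U := (tgaU alpha).

Lemma tgaU_comp g : tga_comp alpha g (U g).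
Proof. by exists 1; rewrite scale1r. Qed.

Lemma tgaU_mulE g h : U (g * h)%g = (alpha g h)^-1 *: (U g * U h).
Proof. by rewrite tgaUM scalerA mulVf ?coc_neq0 // scale1r. Qed.

(** The cocycle scalars cancel in a conjugation, so that conjugating by the [U_g]
    is a genuine action of the group. *)
Lemma tgaU_conjM g h (x : twisted_group_algebra alpha) :
  U (g * h)%g * x * (U (g * h)%g)^-1 = U g * (U h * x * (U h)^-1) * (U g)^-1.
Proof.
rewrite tgaU_mulE invrZ ?unitrMl ?tgaU_unit ?unitfE ?invr_eq0 ?coc_neq0 //.
rewrite invrK invrM ?tgaU_unit // -!scalerAl -!scalerAr scalerA.
by rewrite mulVf ?coc_neq0 // scale1r !mulrA.
Qed.

End TwistedGroupAlgebra.

Section CommutationFunction.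

Context {F : fieldType} {gT : finGroupType} {theta : comm_fun F gT}.
Context {alpha : cocycle F gT}.
Hypothesis reg_alpha : is_regular_grading
  (A := assoc_of_algType (twisted_group_algebra alpha))
  (tga_comp alpha) (tau_twist theta).

Local Notation U := (tgaU alpha).
Local Notation psi := (psi theta).

Lemma tgaU_comm g h : commute g h ->
  U g * U h = (tau2 (psi g) (psi h) * comm2 theta g h) *: (U h * U g).
Proof.
move=> cgh; rewrite -comm2_tau_twist.
exact: (regular_comm2 reg_alpha cgh (tgaU_comp g) (tgaU_comp h)).
Qed.

(** [U_g] commutes with itself, so the commutation function of the twisted group
    algebra is 1 at [(g, g)]. *)
Lemma tau2_psi_psi g : tau2 (psi g) (psi g) * psi g = 1.
Proof.
have UU_neq0 : U g * U g != 0.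
  apply: contraTneq (tgaU_unit alpha g) => UU0.
  by rewrite -(unitrX_pos _ (isT : (0 < 2)%N)) expr2 UU0 unitr0.
by apply: (scaler_injr UU_neq0); rewrite scale1r -tgaU_comm.
Qed.

Lemma psi_sign g : (psi g == 1) || (psi g == -1).
Proof.
have := tau2_psi_psi g; rewrite {1}/tau2.
have [->|_] := eqVneq (psi g) (-1); rewrite ?eqxx ?orbT // mul1r => ->.
by rewrite eqxx.
Qed.

(** By [psiE] for the twisted group algebra, where the diagonal values are 1, the
    Grassmann sign [psi g * psi h] and the value of [theta] are inverse to each
    other. *)
Lemma theta_block_swap g h :
  theta [tuple g; h; g; h] block_swap = psi g * psi h.
Proof.
have := psiE reg_alpha g h.
rewrite {1}/Defs.psi comm2_tau_twist tau2_psi_psi /tau_twist.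
have -> : [tuple of map psi [tuple g; h; g; h]] =
   [tuple psi g; psi h; psi g; psi h] by apply: val_inj.
rewrite tau_block_swap ?psi_sign // => e.
have sq k : psi k * psi k = 1.
  by case/orP: (psi_sign k) => /eqP->; rewrite ?mulrNN mulr1.
have pp : psi g * psi h * (psi g * psi h) = 1 by rewrite mulrACA !sq mulr1.
by rewrite -[LHS]mul1r -pp -mulrA -e mulr1.
Qed.

Lemma psiM (A : assocAlgebra F) (comp : gT -> A -> Prop) :
  is_regular_grading comp theta -> {morph psi : g h / (g * h)%g >-> g * h}.
Proof. by move=> regA g h; rewrite (psiE regA) theta_block_swap. Qed.

(** * The square of the commutation matrix *)

Definition twisted_conj_sum w : twisted_group_algebra alpha :=
  \sum_k tau2 (psi w) (psi k) *: (U k * U w * (U k)^-1).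

(** Multiplicativity of [psi] is inherited from the regular grading of the original
    algebra by [psiM]; isolating it keeps that algebra out of what follows. *)
Hypothesis psi_morph : {morph psi : g h / (g * h)%g >-> g * h}.

Lemma tau2_psiMr w g h :
  tau2 (psi w) (psi (g * h)%g) = tau2 (psi w) (psi g) * tau2 (psi w) (psi h).
Proof. by rewrite psi_morph tau2C tau2Ml ?psi_sign // ![tau2 _ (psi w)]tau2C. Qed.

Lemma twisted_conj_sum1 : twisted_conj_sum 1%g = #|gT|%:R *: U 1%g.
Proof.
have psi1 : psi 1%g = 1.
  have psi1_neq0 : psi 1%g != 0.
    by case/orP: (psi_sign 1%g) => /eqP->; rewrite ?oppr_eq0 oner_eq0.
  by apply: (mulfI psi1_neq0); rewrite -psi_morph mulg1 mulr1.
rewrite scaler_nat -sumr_const; apply: eq_big => // k _.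
have -> : U 1%g = alpha 1%g 1%g *: 1.
  by rewrite tga1E scalerA divff ?coc_neq0 // scale1r.
by rewrite psi1 tau2_1l scale1r -scalerAr mulr1 -scalerAl divrr ?tgaU_unit.
Qed.

(** Conjugation by [U_c] multiplies [U_w] by the inverse of
    [tau2 (psi w) (psi c) * comm2 theta w c].  Replacing [k] by [k * c] also changes
    the sign by [tau2 (psi w) (psi c)], and only [comm2 theta w c] survives. *)
Lemma twisted_conj_sum_scale w c : commute w c ->
  twisted_conj_sum w = comm2 theta w c *: twisted_conj_sum w.
Proof.
move=> cwc; rewrite scaler_sumr [RHS](reindex_inj (mulIg c)).
apply: eq_bigr => k _ /=.
have {1}-> : U w = (tau2 (psi w) (psi c) * comm2 theta w c) *:
    (U c * U w * (U c)^-1).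
  by rewrite scalerAl -tgaU_comm // mulrK ?tgaU_unit.
rewrite -scalerAr -scalerAl -tgaU_conjM !scalerA tau2_psiMr; congr (_ *: _).
by rewrite mulrA mulrC.
Qed.

Lemma twisted_conj_sum0 w :
  is_nondegenerate theta -> w != 1%g -> twisted_conj_sum w = 0.
Proof.
move=> nondeg /nondeg[c /cent1P cwc]; apply: contraNeq => Sw_neq0.
apply/eqP/(scaler_injr Sw_neq0).
by rewrite scale1r -twisted_conj_sum_scale //; apply: commute_sym.
Qed.

(** The factors [U_k^-1 U_k] in the middle of the product of two commutators
    cancel, and the conjugation by [U_k] that remains acts on [U_g^-1 U_h], a
    multiple of [U_w]. *)
Lemma commutation_mx_sqrE i j (g := enum_val i) (h := enum_val j)
    (w := (g^-1 * h)%g) :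
  (commutation_mx alpha theta *m commutation_mx alpha theta) i j =
    (alpha g w)^-1 *: (U g * twisted_conj_sum w * (U h)^-1).
Proof.
have hE : h = (g * w)%g by rewrite mulKVg.
pose entry k := tau2 (psi w) (psi k) *:
   (U g * (U k * ((U g)^-1 * U h) * (U k)^-1) * (U h)^-1).
transitivity (\sum_k entry k).
  rewrite mxE [RHS](big_enum_val (A := gT)); apply: eq_bigr => k _.
  rewrite !mxE -/g -/h; move: (enum_val k) => {}k.
  rewrite -scalerAl -scalerAr scalerA /entry; congr (_ *: _).
    (* With [h = g * w], the sign of [(g, k)] occurs twice and cancels. *)
    rewrite hE tau2_psiMr [tau2 (psi g) (psi k)]tau2C.
    by rewrite mulrA tau2_sqr mul1r tau2C.
  by rewrite !mulrA mulrVK ?tgaU_unit.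
have UVU : (U g)^-1 * U h = (alpha g w)^-1 *: U w.
  by rewrite hE tgaU_mulE -scalerAr mulKr ?tgaU_unit.
rewrite mulr_sumr mulr_suml scaler_sumr; apply: eq_bigr => k _.
by rewrite /entry UVU -!(scalerAr, scalerAl) !scalerA mulrC.
Qed.

End CommutationFunction.

Theorem theorem14 (F : closedFieldType) (charF0 : [pchar F] =i pred0)
  (gT : finGroupType) (A : assocAlgebra F) (comp : gT -> A -> Prop)
  (theta : comm_fun F gT)
  (regA : is_regular_grading comp theta)
  (nondegA : is_nondegenerate theta)
  (alpha : cocycle F gT)
  (reg_alpha : is_regular_grading
     (A := assoc_of_algType (twisted_group_algebra alpha))
     (tga_comp alpha) (tau_twist theta)) :
  commutation_mx alpha theta *m commutation_mx alpha theta = (#|gT|%:R)%:M.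
Proof.
have psi_morph := psiM reg_alpha regA.
apply/matrixP => i j; rewrite (commutation_mx_sqrE reg_alpha psi_morph) mxE.
have [->|neq_ij] := eqVneq i j.
  rewrite mulVg (twisted_conj_sum1 reg_alpha psi_morph) cocg1.
  rewrite -scalerAr -scalerAl tgaUM mulg1 cocg1 -scalerAl.
  rewrite divrr ?tgaU_unit // 2!scalerA mulrCA mulVf ?coc_neq0 // mulr1.
  by rewrite scaler_nat.
rewrite (twisted_conj_sum0 reg_alpha psi_morph nondegA).
  by rewrite mulr0 mul0r scaler0.
apply: contra neq_ij => /eqP/(canRL (mulKVg _)).
by rewrite mulg1 => /enum_val_inj->.
Qed.
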